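(* Consider the noiseless linear system $\mathbf{x}(t+1)=\mathbf{A}\mathbf{x}(t)$, $\mathbf{y}(t)=\mathbf{C}\mathbf{x}(t)$ (no attacks) with state dimension $n$ and $p$ sensors. If the system is $\theta$-sparse observable, then the minimum (symbol) Hamming distance between observation vectors corresponding to distinct initial states is $\theta+1$.
   Context: Here $\mathbf{x}(t)\in\mathbb{R}^n$, $\mathbf{y}(t)\in\mathbb{R}^p$. For $\mathbf{s}\subseteq\{1,\dots,p\}$, $\mathbf{C}_{\mathbf{s}}$ is the matrix of rows of $\mathbf{C}$ indexed by $\mathbf{s}$. The system is $\theta$-sparse observable if for every $\mathbf{s}$ with $|\mathbf{s}|=p-\theta$ the pair $(\mathbf{A},\mathbf{C}_{\mathbf{s}})$ is observable; here, by convention, $\theta$ is the largest positive integer such that the initial state can be recovered by observing any $p-\theta$ sensors. For an initial state $\mathbf{x}(0)$, the symbol of sensor $d\in\{1,\dots,p\}$ is the vector $\mathcal{Y}_d=(y_d(0),y_d(1),\dots,y_d(n-1))\in\mathbb{R}^n$ of its outputs at times $0,\dots,n-1$, and the observation vector is $\mathcal{Y}=[\mathcal{Y}_1\ \mathcal{Y}_2\ \cdots\ \mathcal{Y}_p]$. The (symbol) Hamming distance between two observation vectors $\mathcal{Y}^{(1)},\mathcal{Y}^{(2)}$ is the number of indices $d$ with $\mathcal{Y}^{(1)}_d\neq\mathcal{Y}^{(2)}_d$. The minimum is over pairs of distinct initial states $\mathbf{x}^{(1)}(0)\ne\mathbf{x}^{(2)}(0)$. *)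

(* Defs.v *)
From HB Require Import structures.
From mathcomp Require Import all_boot all_order all_algebra.
From mathcomp Require Import reals.

Set Implicit Arguments.
Unset Strict Implicit.
Unset Printing Implicit Defensive.

Import Order.TTheory GRing.Theory Num.Theory.
Local Open Scope ring_scope.

Definition is_least (S : nat -> Prop) (m : nat) : Prop :=
  S m /\ forall k, S k -> (m <= k)%N.

Definition is_greatest (S : nat -> Prop) (m : nat) : Prop :=
  S m /\ forall k, S k -> (k <= m)%N.

Definition state (R : realType) (n : nat) (A : 'M[R]_n) (x0 : 'cV[R]_n)
    (t : nat) : 'cV[R]_n :=
  iter t (mulmx A) x0.

Definition output (R : realType) (n p : nat) (A : 'M[R]_n) (C : 'M[R]_(p, n))
    (x0 : 'cV[R]_n) (t : nat) : 'cV[R]_p :=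
  C *m state A x0 t.

(* Observability in the system-theoretic sense: the initial state is uniquely
   determined by the whole output sequence y(0), y(1), y(2), and so on; no
   finite horizon is built in. *)
Definition observable (R : realType) (n p : nat) (A : 'M[R]_n)
    (C : 'M[R]_(p, n)) : Prop :=
  forall x1 x2 : 'cV[R]_n,
    (forall t : nat, output A C x1 t = output A C x2 t) -> x1 = x2.

Definition sensor_rows (R : realType) (n p : nat) (C : 'M[R]_(p, n))
    (s : {set 'I_p}) : 'M[R]_(#|s|, n) :=
  rowsub (fun i : 'I_#|s| => enum_val i) C.

(* The bound theta <= p keeps the truncated subtraction p - theta exact. *)
Definition sparse_observable (R : realType) (n p : nat) (A : 'M[R]_n)
    (C : 'M[R]_(p, n)) (theta : nat) : Prop :=
  (theta <= p)%N /\
  forall s : {set 'I_p}, #|s| = (p - theta)%N -> observable A (sensor_rows C s).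

(* By convention theta is the largest positive integer with this property. *)
Definition max_sparse_observable (R : realType) (n p : nat) (A : 'M[R]_n)
    (C : 'M[R]_(p, n)) (theta : nat) : Prop :=
  is_greatest (fun k => (0 < k)%N /\ sparse_observable A C k) theta.

Definition symbol (R : realType) (n p : nat) (A : 'M[R]_n) (C : 'M[R]_(p, n))
    (x0 : 'cV[R]_n) (d : 'I_p) : 'rV[R]_n :=
  \row_(t < n) output A C x0 t d 0.

Definition observation (R : realType) (n p : nat) (A : 'M[R]_n)
    (C : 'M[R]_(p, n)) (x0 : 'cV[R]_n) : {ffun 'I_p -> 'rV[R]_n} :=
  [ffun d => symbol A C x0 d].

Definition hamming_dist (T : eqType) (p : nat) (u v : {ffun 'I_p -> T}) : nat :=
  #|[set d | u d != v d]|.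

(* Main.v *)
Require Import Defs.
From HB Require Import structures.
From mathcomp Require Import all_boot all_order all_algebra.
From mathcomp Require Import boolp reals.

(** A system is [k]-sparse observable exactly when distinct initial states
    always have observation vectors at distance greater than [k]
    ([sparse_observableP]): two observation vectors are within distance [k] if
    and only if their symbols agree on some set of [p - k] sensors, and
    agreement of the symbols there means that those sensors never tell the two
    states apart.  The last point is the one where the dynamics enter: a symbol
    records only the outputs at times [0, ..., n - 1], and Cayley-Hamilton makes
    every later output a fixed linear combination of these
    ([output_lincomb], [eq_symbolP]).

    If [theta] is the largest such [k], then all distances exceed [theta],
    whereas some pair of distinct states is at distance at most [theta + 1],
    since otherwise [theta + 1] would qualify as well.  The bound
    [theta + 1 <= p] required for that last step comes from any pair of distinct
    states, which exists because [n > 0]: their distance exceeds [theta] and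
    cannot exceed [p]. *)

Set Implicit Arguments.
Unset Strict Implicit.
Unset Printing Implicit Defensive.

Import Order.TTheory GRing.Theory Num.Theory.
Local Open Scope ring_scope.

Lemma subset_of_card (T : finType) (B : {set T}) (k : nat) :
  (k <= #|B|)%N -> exists2 s : {set T}, s \subset B & #|s| = k.
Proof.
move=> le_kB; exists [set x in take k (enum B)].
  by apply/subsetP => x; rewrite inE => /mem_take; rewrite mem_enum.
rewrite cardsE (card_uniqP _) ?take_uniq ?enum_uniq //.
by rewrite size_takel // -cardE.
Qed.

Lemma stateE (R : realType) (n : nat) (A : 'M[R]_n.+1) x0 t :
  state A x0 t = A ^+ t *m x0.
Proof.
elim: t => [|t IHt]; first by rewrite expr0 mul1mx.
by rewrite /state iterS -/(state A x0 t) IHt mulmxA exprS.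
Qed.

(** The coefficients are those of the remainder of ['X^t] modulo the
    characteristic polynomial of [A]; they depend neither on the initial state
    nor on the sensor, so that equal symbols force equal outputs. *)
Lemma output_lincomb (R : realType) (n : nat) (A : 'M[R]_n) (t : nat) :
  (0 < n)%N ->
  exists a : 'I_n -> R, forall (p : nat) (C : 'M[R]_(p, n)) x0,
    output A C x0 t = \sum_(i < n) a i *: output A C x0 i.
Proof.
case: n A => // n A _.
pose q := 'X^t %% char_poly A.
have size_q : (size q <= n.+1)%N.
  by rewrite -ltnS -(size_char_poly A) ltn_modp monic_neq0 ?char_poly_monic.
have At : A ^+ t = \sum_(i < n.+1) q`_i *: A ^+ i.
  have -> : A ^+ t = horner_mx A 'X^t by rewrite rmorphXn /= horner_mx_X.
  rewrite (divp_eq 'X^t (char_poly A)) rmorphD rmorphM /= Cayley_Hamilton.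
  rewrite mulr0 add0r -/q {1}(_ : q = \poly_(i < n.+1) q`_i).
    rewrite poly_def raddf_sum /=; apply: eq_bigr => i _.
    by rewrite linearZ /= rmorphXn /= horner_mx_X.
  by apply/polyP=> i; rewrite coef_poly; case: ltnP => // /(leq_trans size_q)
     /leq_sizeP->.
exists (fun i => q`_i) => p C x0.
rewrite /output stateE At mulmx_suml mulmx_sumr; apply: eq_bigr => i _.
by rewrite stateE -scalemxAl -scalemxAr.
Qed.

Lemma eq_symbolP (R : realType) (n p : nat) (A : 'M[R]_n) (C : 'M[R]_(p, n))
    x1 x2 (d : 'I_p) : (0 < n)%N ->
  symbol A C x1 d = symbol A C x2 d <->
  (forall t, output A C x1 t d 0 = output A C x2 t d 0).
Proof.
move=> n_gt0; split=> [/rowP eq12 t | eq12]; last first.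
  by apply/rowP=> i; rewrite [LHS]mxE [RHS]mxE eq12.
have [a outE] := output_lincomb A t n_gt0.
rewrite !outE !summxE; apply: eq_bigr => i _.
have := eq12 i; rewrite [LHS]mxE [RHS]mxE => eq_out.
by rewrite [LHS]mxE [RHS]mxE eq_out.
Qed.

Lemma output_sensor_rows (R : realType) (n p : nat) (A : 'M[R]_n)
    (C : 'M[R]_(p, n)) (s : {set 'I_p}) x0 t i :
  output A (sensor_rows C s) x0 t i 0 = output A C x0 t (enum_val i) 0.
Proof. by rewrite /output /sensor_rows mul_rowsub_mx mxE. Qed.

Lemma observable_sensor_rowsP (R : realType) (n p : nat) (A : 'M[R]_n)
    (C : 'M[R]_(p, n)) (s : {set 'I_p}) : (0 < n)%N ->
  observable A (sensor_rows C s) <->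
  (forall x1 x2, {in s, observation A C x1 =1 observation A C x2} -> x1 = x2).
Proof.
move=> n_gt0; split=> obs x1 x2 eq12; apply: obs.
  move=> t; apply/colP=> i; rewrite !output_sensor_rows.
  have := eq12 _ (enum_valP i); rewrite !ffunE.
  by move/(eq_symbolP A C x1 x2 _ n_gt0).
move=> d ds; rewrite !ffunE; apply/eq_symbolP => // t.
by rewrite -(enum_rankK_in ds ds) -!output_sensor_rows eq12.
Qed.

(** Distance at most [k] means agreement on at least [p - k] sensors, out of
    which exactly [p - k] can be selected. *)
Lemma hamming_dist_leP (T : eqType) (p k : nat) (u v : {ffun 'I_p -> T}) :
  (k <= p)%N ->
  (hamming_dist u v <= k)%N <->
  exists2 s : {set 'I_p}, #|s| = (p - k)%N & {in s, u =1 v}.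
Proof.
move=> le_kp; rewrite /hamming_dist; set D := [set d | u d != v d].
have cardD : (#|D| + #|~: D|)%N = p by rewrite cardsC card_ord.
split=> [le_Dk | [s card_s eq_uv]].
  have [|s sD card_s] := @subset_of_card _ (~: D) (p - k).
    by rewrite leq_subLR -{1}cardD leq_add2r.
  by exists s => // d /(subsetP sD); rewrite !inE negbK => /eqP.
have sD : s \subset ~: D.
  by apply/subsetP=> d ds; rewrite !inE negbK eq_uv.
have := subset_leq_card sD.
by rewrite card_s leq_subLR -{1}cardD leq_add2r.
Qed.

Lemma sparse_observableP (R : realType) (n p : nat) (A : 'M[R]_n)
    (C : 'M[R]_(p, n)) (k : nat) : (0 < n)%N -> (k <= p)%N ->
  sparse_observable A C k <->
  (forall x1 x2, x1 <> x2 ->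
     (k < hamming_dist (observation A C x1) (observation A C x2))%N).
Proof.
move=> n_gt0 le_kp; split=> [[_ obs] x1 x2 neq12 | dist_gt].
  rewrite ltnNge; apply/negP => /(hamming_dist_leP _ _ le_kp) [s card_s eq12].
  by apply: neq12; move/(observable_sensor_rowsP A C s n_gt0): (obs s card_s);
     apply.
split=> // s card_s; apply/observable_sensor_rowsP => // x1 x2 eq12.
apply: contrapT => /dist_gt; rewrite ltnNge => /negP; apply.
by apply/hamming_dist_leP => //; exists s.
Qed.

Theorem lemma2 (R : realType) (n p : nat) (A : 'M[R]_n) (C : 'M[R]_(p, n))
    (theta : nat) (hn : (0 < n)%N) (hobs : max_sparse_observable A C theta) :
  is_least
    (fun k : nat => exists x1 x2 : 'cV[R]_n,
       x1 <> x2 /\ k = hamming_dist (observation A C x1) (observation A C x2))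
    (theta + 1)%N.
Proof.
case: hobs => [[theta_gt0 sparse] theta_max]; rewrite addn1.
have [le_theta_p _] := sparse.
have /(sparse_observableP A C hn le_theta_p) dist_gt := sparse.
split=> [|_ [x1 [x2 [neq12 ->]]]]; last exact: dist_gt.
have lt_theta_p : (theta < p)%N.
  have neq10 : const_mx 1 <> 0 :> 'cV[R]_n.
    by move/colP/(_ (Ordinal hn)); rewrite !mxE; apply/eqP/oner_neq0.
  apply: leq_trans (dist_gt _ _ neq10) _.
  by rewrite -[leqRHS]card_ord; apply: max_card.
apply: contrapT => no_pair.
suff sparseS : sparse_observable A C theta.+1.
  by have := theta_max theta.+1 (conj isT sparseS); rewrite ltnn.
apply/sparse_observableP => // x1 x2 neq12.
rewrite ltn_neqAle dist_gt // andbT; apply/eqP => distE.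
by apply: no_pair; exists x1, x2.
Qed.
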